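(* Let $\alpha=a/b$ with $a\in\mathbb{N}$, $b\in\mathbb{Z}$, $a>|b|\geq 1$ and $\gcd(a,b)=1$. If $a\neq b+1$, then $\alpha\in\mathcal{F}_{|M_\alpha(0)|}$; if $a=b+1$, then $\alpha\in\mathcal{F}_{2|M_\alpha(0)|-1}$. Moreover, a set $S_\alpha$ (a finite set $S\subset\mathbb{C}$ of minimal cardinality with $\mathbb{Z}[\alpha]=S[\alpha]$) can be chosen so that $0\in S_\alpha\subset\mathbb{Z}$.
   Context: For $S\subset\mathbb{C}$ and $\alpha\in\mathbb{C}$, $S[\alpha]:=\{\sum_{j=0}^n f_j\alpha^j : n\in\mathbb{N},\ (f_0,\ldots,f_n)\in S^{n+1}\}$. For an algebraic number $\alpha$, $M_\alpha\in\mathbb{Z}[x]$ is its primitive minimal polynomial over $\mathbb{Q}$ (integer coefficients with gcd $1$). For an algebraic number $\alpha$ for which some finite $S\subset\mathbb{C}$ satisfies $\mathbb{Z}[\alpha]=S[\alpha]$, let $S_\alpha$ denote such a finite set of minimal cardinality; for $N\in\mathbb{N}$, $\mathcal{F}_N$ is the set of algebraic numbers $\alpha$ for which such a set exists and $\operatorname{Card}(S_\alpha)=N$. *)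

(* Defs.v *)
From HB Require Import structures.
From mathcomp Require Import all_boot all_order all_algebra.
From mathcomp Require Import complex.
From mathcomp Require Import all_classical all_reals.
Set Implicit Arguments.
Unset Strict Implicit.
Unset Printing Implicit Defensive.
Import Order.TTheory GRing.Theory Num.Theory.
Local Open Scope classical_set_scope.
Local Open Scope card_scope.
Local Open Scope ring_scope.

Definition intset (R : realType) : set R[i] := range (intr : int -> R[i]).

(* S[alpha], with n ranging over the natural numbers including 0, so that
   S is a subset of S[alpha]. *)
Definition adjoin (R : realType) (S : set R[i]) (alpha : R[i]) : set R[i] :=
  [set x | exists n : nat, exists f : 'I_n.+1 -> R[i],
     (forall j, S (f j)) /\ x = \sum_(j < n.+1) f j * alpha ^+ j].

Definition digit_set (R : realType) (alpha : R[i]) (S : set R[i]) : Prop :=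
  finite_set S /\ adjoin (@intset R) alpha = adjoin S alpha.

Definition min_digit_set (R : realType) (alpha : R[i]) (S : set R[i]) : Prop :=
  digit_set alpha S /\ forall T : set R[i], digit_set alpha T -> S #<= T.

(* [zcontents M = 1] says that the gcd of the coefficients is 1 and that the
   leading coefficient is positive; the latter only fixes the sign of M. *)
Definition is_prim_minpoly (R : realType) (alpha : R[i]) (M : {poly int}) :
  Prop :=
  [/\ zcontents M = 1,
      root (map_poly (intr : int -> R[i]) M) alpha
    & forall q : {poly rat}, q != 0 ->
        root (map_poly (ratr : rat -> R[i]) q) alpha ->
        (size M <= size q)%N].

(* The default value 0 is taken exactly when alpha is transcendental. *)
Definition prim_minpoly (R : realType) (alpha : R[i]) : {poly int} :=
  xget 0 [set M | is_prim_minpoly alpha M].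

Definition calF (R : realType) (N : nat) : set R[i] :=
  [set alpha | algebraicOver (ratr : rat -> R[i]) alpha /\
     exists S : set R[i], min_digit_set alpha S /\ S #= `I_N].

(* Main.v *)
Require Import Defs.
From HB Require Import structures.
From mathcomp Require Import all_boot all_order all_algebra.
From mathcomp Require Import complex.
From mathcomp Require Import all_classical all_reals.
From mathcomp Require Import zify ring.
Set Implicit Arguments.
Unset Strict Implicit.
Unset Printing Implicit Defensive.
Import Order.TTheory GRing.Theory Num.Theory.
Local Open Scope classical_set_scope.
Local Open Scope ring_scope.
Local Open Scope card_scope.

(** The ring [Z[a/b]] is [Z[1/b]], and reduction modulo [alpha = a/b] identifies
    its residue ring with [Z/aZ], so a digit set contains a complete residue
    system modulo [a].  If [a = b + 1] and [d] is the only digit in its class,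
    then [- b d = d + alpha (- b d)] forces every expansion of [- b d] to
    consist of digits [d] only, whence [- b d = d] and [d = 0]: each of the
    [a - 1] nonzero classes needs two digits.

    Conversely, stripping digits that form a complete residue system brings
    every element to the form [b q] with [q] an integer, and
    [b q = d + alpha (b q')] as soon as [b q = d + a q'].  So it suffices to
    choose the digits such that [q |-> q'] always leads to [0].  This holds for
    [{0, .., a - 1}] if [b < 0], for [{- b, .., b}] if [a = b + 1], and
    otherwise, with [c = a - b >= 2], for the set obtained from
    [{0, .., a - 1}] by replacing each nonzero multiple [r] of [c], which would
    create a nonzero fixed point of [q |-> q'], by [r - a]. *)

(** * Expansions in base [alpha] *)

Lemma adjoin_digit (R : realType) (S : set R[i]) (alpha x : R[i]) :
  S x -> adjoin S alpha x.
Proof.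
move=> Sx; exists 0%N, (fun=> x); split => //.
by rewrite big_ord1 expr0 mulr1.
Qed.

Lemma adjoin_cons (R : realType) (S : set R[i]) (alpha d x : R[i]) :
  S d -> adjoin S alpha x -> adjoin S alpha (d + alpha * x).
Proof.
move=> Sd [n [f [Sf ->]]].
exists n.+1, (fun j => oapp f d (unlift ord0 j)); split.
  by move=> j; case: unliftP => [k|] _ /=.
rewrite [RHS]big_ord_recl /= unlift_none /= expr0 mulr1 mulr_sumr; congr (_ + _).
apply: eq_bigr => j _; rewrite liftK /= -[bump 0 j]/(j.+1) exprS.
by rewrite mulrCA.
Qed.

(** Horner's scheme: splitting off the term of degree 0 leaves [alpha] times a shorter expansion. *)
Lemma adjoin_ind (R : realType) (S : set R[i]) (alpha : R[i])
    (P : R[i] -> Prop) :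
  (forall x, S x -> P x) ->
  (forall d x, S d -> adjoin S alpha x -> P x -> P (d + alpha * x)) ->
  forall x, adjoin S alpha x -> P x.
Proof.
move=> P0 P1 x [n [f [Sf ->]]].
elim: n f Sf => [|n IHn] f Sf; first by rewrite big_ord1 expr0 mulr1; exact: P0.
rewrite big_ord_recl expr0 mulr1.
under eq_bigr => j _ do rewrite lift0 exprS mulrCA.
rewrite -mulr_sumr; apply: P1 => //; last exact: IHn.
by exists n, (fun j => f (lift ord0 j)).
Qed.

(** * The ring Z[1/b], encoded as [int_inv b], and its residues modulo a/b *)

Definition int_inv (R : realType) (b : int) : set R[i] :=
  [set x | exists k : nat, exists p : int, x * b%:~R ^+ k = p%:~R].

Lemma int_inv_int (R : realType) (b p : int) : int_inv b (p%:~R : R[i]).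
Proof. by exists 0%N, p; rewrite expr0 mulr1. Qed.

Lemma int_invD (R : realType) (b : int) (x y : R[i]) :
  int_inv b x -> int_inv b y -> int_inv b (x + y).
Proof.
move=> [k [p xp]] [l [q yq]]; exists (k + l)%N, (p * b ^+ l + q * b ^+ k).
rewrite rmorphD !rmorphM /= !rmorphXn /= -xp -yq exprD; ring.
Qed.

Lemma int_invM (R : realType) (b : int) (x y : R[i]) :
  int_inv b x -> int_inv b y -> int_inv b (x * y).
Proof.
move=> [k [p xp]] [l [q yq]]; exists (k + l)%N, (p * q).
rewrite !rmorphM /= -xp -yq exprD; ring.
Qed.

Lemma int_invN (R : realType) (b : int) (x : R[i]) :
  int_inv b x -> int_inv b (- x).
Proof.
by move=> [k [p xp]]; exists k, (- p); rewrite mulNr xp rmorphN.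
Qed.

Lemma int_inv_frac (R : realType) (a : nat) (b : int) :
  b != 0 -> int_inv b (a%:R / b%:~R : R[i]).
Proof.
move=> b0; exists 1%N, a%:Z.
by rewrite expr1 mulfVK ?intr_eq0 // pmulrn.
Qed.

(** By Bezout [b ^+ k] is invertible modulo [a], and [y] is the quotient of [p] by it. A digit in
    the class of [y] can thus be stripped from the fraction p / b^k. *)
Lemma dvdz_pow_coprime (a b p : int) (k : nat) :
  coprimez a b -> exists y : int, forall d : int,
    (a %| y - d)%Z -> (a %| p - d * b ^+ k)%Z.
Proof.
move=> /(coprimezXr k)/coprimezP[[u v] /= uv].
exists (p * v) => d /dvdzP[m pvd]; apply/dvdzP.
exists (p * u + m * b ^+ k).
have -> : (p * u + m * b ^+ k) * a = p * u * a + m * a * b ^+ k by ring.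
by rewrite -pvd -{1}[p]mulr1 -uv; ring.
Qed.

(** Each stripped digit lowers the exponent of [b] in the denominator by one. Once an integer [p] is
    left, [p = d + a m = d + alpha (b m)], and the last hypothesis expands [b m]. *)
Lemma adjoin_eq_int_inv (R : realType) (a : nat) (b : int) (S : set R[i]) :
  b != 0 -> coprimez a b -> S `<=` @intset R ->
  (forall x : int, exists d : int, S d%:~R /\ (a%:Z %| x - d)%Z) ->
  (forall q : int, adjoin S (a%:R / b%:~R) (b * q)%:~R) ->
  adjoin S (a%:R / b%:~R) = int_inv b.
Proof.
move=> b0 cab SZ Sfull Sb; have b0' : b%:~R != 0 :> R[i] by rewrite intr_eq0.
apply/seteqP; split.
  apply: adjoin_ind => [x /SZ[p _ <-]|d x /SZ[p _ <-] _ xb].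
    exact: int_inv_int.
  apply: int_invD; first exact: int_inv_int.
  by apply: int_invM => //; exact: int_inv_frac.
move=> x [k [p]]; elim: k x p => [|k IHk] x p.
  rewrite expr0 mulr1 => ->; have [d [Sd /dvdzP[m pd]]] := Sfull p.
  have -> : p%:~R = d%:~R + a%:R / b%:~R * (b * m)%:~R :> R[i].
    rewrite (_ : p = d + m * a); last by rewrite -pd addrC subrK.
    by rewrite rmorphD /= !rmorphM /= -pmulrn; field.
  exact: adjoin_cons.
move=> xp; have [y hy] := dvdz_pow_coprime p k.+1 cab.
have [d [Sd /hy /dvdzP[m pd]]] := Sfull y.
pose z : R[i] := m%:~R / b%:~R ^+ k.
have -> : x = d%:~R + a%:R / b%:~R * z.
  apply: (mulIf (expf_neq0 k.+1 b0')); rewrite xp /z.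
  rewrite (_ : p = d * b ^+ k.+1 + m * a); last by rewrite -pd addrC subrK.
  rewrite rmorphD /= !rmorphM /= rmorphXn /= -pmulrn exprS; field.
  by rewrite b0' expf_neq0.
apply: adjoin_cons => //; apply: (IHk _ m).
by rewrite /z mulfVK // expf_neq0.
Qed.

Lemma adjoin_int (R : realType) (a : nat) (b : int) :
  b != 0 -> coprimez a b ->
  adjoin (@intset R) (a%:R / b%:~R) = int_inv b.
Proof.
move=> b0 cab; apply: adjoin_eq_int_inv => // [x|q].
  by exists x; rewrite subrr dvdz0; split => //; exists x.
by apply: adjoin_digit; exists (b * q).
Qed.

Lemma adjoin_step (R : realType) (a : nat) (b d q q' : int) (S : set R[i]) :
  b != 0 -> S d%:~R -> b * q = d + a%:Z * q' ->
  adjoin S (a%:R / b%:~R) (b * q')%:~R -> adjoin S (a%:R / b%:~R) (b * q)%:~R.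
Proof.
move=> b0 Sd -> /(adjoin_cons Sd).
rewrite !rmorphD !rmorphM /= -pmulrn; congr adjoin; congr (_ + _).
by field; rewrite intr_eq0.
Qed.

(** Clearing denominators turns the equation into [p * b ^+ k.+1 = m * a], and [a] is coprime to
    [b]. Hence integers congruent modulo [alpha] in Z[1/b] are congruent modulo [a]. *)
Lemma dvdz_frac_intr (R : realType) (a : nat) (b p : int) (z : R[i]) :
  b != 0 -> coprimez a b -> int_inv b z -> p%:~R = a%:R / b%:~R * z ->
  (a %| p)%Z.
Proof.
move=> b0 cab [k [m zm]] pz; have b0' : b%:~R != 0 :> R[i] by rewrite intr_eq0.
rewrite -(Gauss_dvdzl _ (coprimezXr k.+1 cab)); apply/dvdzP; exists m.
apply: (@intr_inj R[i]); rewrite !rmorphM /= rmorphXn /= pz -zm -pmulrn exprS.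
by field.
Qed.

Lemma digit_set_sub (R : realType) (a : nat) (b : int) (T : set R[i]) :
  b != 0 -> coprimez a b -> digit_set (a%:R / b%:~R) T -> T `<=` int_inv b.
Proof.
by move=> b0 cab [_]; rewrite adjoin_int // => -> t; exact: adjoin_digit.
Qed.

(** * Lower bounds for the number of digits *)

Definition congr_mod (R : realType) (b : int) (alpha x y : R[i]) : Prop :=
  exists z, int_inv b z /\ x - y = alpha * z.

Lemma congr_mod_sym_trans (R : realType) (b : int) (alpha x y z : R[i]) :
  congr_mod b alpha x y -> congr_mod b alpha x z -> congr_mod b alpha y z.
Proof.
move=> [u [bu xy]] [v [bv xz]]; exists (v - u); split.
  by apply: int_invD => //; exact: int_invN.
by rewrite mulrBr -xy -xz; ring.
Qed.

Lemma congr_mod_sym (R : realType) (b : int) (alpha x y : R[i]) :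
  congr_mod b alpha x y -> congr_mod b alpha y x.
Proof.
move=> [u [bu xy]]; exists (- u); split; first exact: int_invN.
by rewrite mulrN -xy opprB.
Qed.

(** The lowest digit of any expansion of [x] serves as [t]. *)
Lemma digit_congr_mod (R : realType) (a : nat) (b : int) (T : set R[i])
    (x : R[i]) :
  b != 0 -> coprimez a b -> digit_set (a%:R / b%:~R) T -> int_inv b x ->
  exists t, T t /\ congr_mod b (a%:R / b%:~R) x t.
Proof.
move=> b0 cab [_]; rewrite adjoin_int // => bT; rewrite {1}bT.
apply: (adjoin_ind (P := fun y => exists t, T t /\ congr_mod b _ y t)).
  move=> {}x Tx; exists x; split => //; exists 0; split.
    exact: (@int_inv_int _ _ 0).
  by rewrite subrr mulr0.
move=> d {}x Td Tx _; exists d; split => //; exists x; rewrite bT; split => //.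
by rewrite addrC addKr.
Qed.

Lemma congr_mod_nat (R : realType) (a : nat) (b : int) (i j : nat) :
  b != 0 -> coprimez a b -> (i < a)%N -> (j < a)%N ->
  congr_mod b (a%:R / b%:~R : R[i]) i%:R j%:R -> i = j.
Proof.
move=> b0 cab ia ja [z [bz ijz]].
have /dvdzP[m] : (a %| i%:Z - j%:Z)%Z.
  by apply: (dvdz_frac_intr b0 cab bz); rewrite -ijz rmorphB /= -!pmulrn.
move=> ij; have : m = 0 by nia.
by move=> m0; rewrite m0 in ij; lia.
Qed.

Lemma card_le_of_inj (U : Type) (N : nat) (T : set U) (g : nat -> U) :
  (forall i, (i < N)%N -> T (g i)) ->
  (forall i j, (i < N)%N -> (j < N)%N -> g i = g j -> i = j) -> `I_N #<= T.
Proof.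
move=> gT ginj.
have gI : g @` `I_N #= `I_N.
  by apply: inj_card_eq => i j; rewrite !inE => iN jN; exact: ginj.
rewrite -(card_le_eql gI); apply: subset_card_le => _ [i iN <-]; exact: gT.
Qed.

Lemma digit_set_card_ge (R : realType) (a : nat) (b : int) (T : set R[i]) :
  b != 0 -> coprimez a b -> digit_set (a%:R / b%:~R) T -> `I_a #<= T.
Proof.
move=> b0 cab dT.
have /choice[g gP] (i : nat) := digit_congr_mod b0 cab dT (int_inv_int R b i).
apply: (card_le_of_inj (g := g)) => [i _|i j ia ja gij].
  by have [] := gP i.
have [_ /congr_mod_sym gi] := gP i; have [_ /congr_mod_sym gj] := gP j.
apply: (@congr_mod_nat R a b) => //; rewrite !pmulrn.
by apply: congr_mod_sym_trans gi _; rewrite gij.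
Qed.

Lemma digit_set_two_digits (R : realType) (a : nat) (b : int) (T : set R[i])
    (r : nat) :
  b != 0 -> coprimez a b -> a%:Z = b + 1 -> (0 < r < a)%N ->
  digit_set (a%:R / b%:~R) T ->
  exists t : R[i] * R[i], [/\ T t.1, T t.2, t.1 <> t.2,
    congr_mod b (a%:R / b%:~R) r%:R t.1 & congr_mod b (a%:R / b%:~R) r%:R t.2].
Proof.
move=> b0 cab ab /andP[r0 ra] dT; set alpha := _ / _ in dT *.
have b0' : b%:~R != 0 :> R[i] by rewrite intr_eq0.
have aE : a%:R = b%:~R + 1 :> R[i] by rewrite pmulrn ab rmorphD.
have [t [Tt rt]] := digit_congr_mod b0 cab dT (int_inv_int R b r).
rewrite -pmulrn in rt.
apply: contrapT => noT.
have uniqt s : T s -> congr_mod b alpha r%:R s -> s = t.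
  move=> Ts rs; apply: contrapT => st; apply: noT; exists (s, t); by split.
have bt : int_inv b t by exact: (digit_set_sub b0 cab dT).
have t0 : t <> 0.
  (* A zero digit would put [r] in the class of 0, although [0 < r < a]. *)
  move=> t0; have /= := @congr_mod_nat R a b r 0 b0 cab ra.
  by rewrite t0 in rt => /(_ _ rt) h; move: r0; rewrite h //; lia.
have bT : int_inv b = adjoin T alpha by case: dT => _ <-; rewrite adjoin_int.
(* The fixed point t / (1 - alpha) of [y |-> t + alpha * y], since here 1 - alpha = -1/b. *)
pose x := - (b%:~R * t).
have bx : int_inv b x.
  by apply: int_invN; apply: int_invM => //; exact: int_inv_int.
have xE : x - t = alpha * x by rewrite /x /alpha aE; field.
have rx : congr_mod b alpha r%:R x.
  apply: (congr_mod_sym_trans (x := t)); first exact: congr_mod_sym.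
  by apply: congr_mod_sym; exists x.
have alpha0 : alpha != 0.
  by rewrite /alpha mulf_neq0 ?invr_neq0 // pnatr_eq0; lia.
have : adjoin T alpha x by rewrite -bT.
(* Induction on expansions: a single digit equal to [x] would be [t], giving [a t = 0]; in a longer
   expansion of [x] the lowest digit is [t], so the remaining part is again [x]. *)
suff : forall y, adjoin T alpha y -> y <> x by move=> /[apply].
apply: adjoin_ind => [s Ts sx|d y Td Ty yx dyx].
  have xt : x = t by rewrite -(uniqt s) // sx.
  apply: t0; apply: (mulfI (x := a%:R)).
    by rewrite pnatr_eq0; lia.
  move: xt; rewrite aE mulr0 mulrDl mul1r => xt.
  by rewrite -{2}xt /x addrN.
apply: yx; have dt : d = t.
  apply: uniqt => //; apply: (congr_mod_sym_trans (x := x)).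
    exact: congr_mod_sym.
  by exists y; rewrite bT; split => //; rewrite -dyx addrC addKr.
by apply: (mulfI alpha0); rewrite -xE -dyx dt addrC addKr.
Qed.

(** One digit in the class of 0 and two in each of the other [a - 1] classes. *)
Lemma digit_set_card_ge_succ (R : realType) (a : nat) (b : int)
    (T : set R[i]) :
  b != 0 -> coprimez a b -> a%:Z = b + 1 ->
  digit_set (a%:R / b%:~R) T -> `I_(2 * a - 1) #<= T.
Proof.
move=> b0 cab ab dT; set alpha := _ / _ in dT *.
have [t0 [Tt0 ct0]] := digit_congr_mod b0 cab dT (int_inv_int R b 0%N).
have /choice[g gP] (i : nat) : exists t : R[i] * R[i], (0 < i < a)%N ->
    [/\ T t.1, T t.2, t.1 <> t.2, congr_mod b alpha i%:R t.1
      & congr_mod b alpha i%:R t.2].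
  have [ia|_] := boolP (0 < i < a)%N; last by exists (0, 0).
  by have [t tP] := digit_set_two_digits b0 cab ab ia dT; exists t.
(* Index 0 lists the digit of class 0, indices 1 to a - 1 the first digits of the nonzero classes,
   and a to 2a - 2 the second ones; [rk i] is the class of [h i]. *)
pose h i := if i == 0%N then t0 else if (i < a)%N then (g i).1
  else (g (i - a).+1).2.
pose rk i := if (i < a)%N then i else (i - a).+1.
have hP i : (i < 2 * a - 1)%N -> T (h i) /\ congr_mod b alpha (rk i)%:R (h i).
  rewrite /h /rk; case: eqVneq => [->|i0] iN.
    by rewrite (_ : (0 < a)%N) //; lia.
  case: ltnP => ia.
    by have [|? _ _ ? _] := gP i => //; lia.
  by have [|_ ? _ _ ?] := gP (i - a).+1 => //; lia.
apply: (card_le_of_inj (g := h)) => [i /hP[]//|i j iN jN hij].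
have [_ /congr_mod_sym hi] := hP _ iN; have [_ /congr_mod_sym hj] := hP _ jN.
have rij : rk i = rk j.
  have rka k : (k < 2 * a - 1)%N -> (rk k < a)%N.
    by rewrite /rk; case: (ltnP k a); lia.
  apply: (@congr_mod_nat R a b) => //; try exact: rka.
  by apply: congr_mod_sym_trans hi _; rewrite hij.
move: hij rij; rewrite /h /rk.
case: (ltnP i a) => ia; case: (ltnP j a) => ja //.
- move=> hij ij; case: eqVneq hij => [i0|i0]; first lia.
  rewrite (_ : (j == 0%N) = false); last lia.
  by have [|_ _ ne _ _] := gP i; [lia|rewrite -ij => /ne].
- move=> hij ij; case: eqVneq hij => [i0|i0]; first lia.
  rewrite (_ : (j == 0%N) = false); last lia.
  by have [|_ _ ne _ _] := gP j; [lia|rewrite ij => /esym/ne].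
- by lia.
Qed.

(** * Optimal digit sets in the three cases *)

(* Quantifying over [P] is an inductive encoding of reachability: the last
   hypothesis says that every integer [q] reaches [0] for a suitable choice of
   digits. *)
Lemma min_digit_set_image (R : realType) (a N : nat) (b : int)
    (dig : nat -> int) :
  b != 0 -> coprimez a b ->
  (forall T : set R[i], digit_set (a%:R / b%:~R) T -> `I_N #<= T) ->
  (forall i j, (i < N)%N -> (j < N)%N -> dig i = dig j -> i = j) ->
  (exists2 i, (i < N)%N & dig i = 0) ->
  (forall x : int, exists2 i, (i < N)%N & (a%:Z %| x - dig i)%Z) ->
  (forall P : int -> Prop, P 0 ->
    (forall q q' i, (i < N)%N -> b * q = dig i + a%:Z * q' -> P q' -> P q) ->
    forall q, P q) ->
  exists S : set R[i], [/\ min_digit_set (a%:R / b%:~R) S, S #= `I_N, S 0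
    & S `<=` @intset R].
Proof.
move=> b0 cab lowN diginj [i0 i0N dig0] digfull digreach.
pose S : set R[i] := (fun i => (dig i)%:~R) @` `I_N.
have SN : S #= `I_N.
  apply: inj_card_eq => i j; rewrite !inE => iN jN /intr_inj; exact: diginj.
have Sdig i : (i < N)%N -> S (dig i)%:~R by move=> iN; exists i.
have S0 : S 0 by exists i0; rewrite // dig0.
have SZ : S `<=` @intset R by move=> _ [i _ <-]; exists (dig i).
exists S; split => //; split.
  split; first by apply/finite_setP; exists N.
  rewrite adjoin_int // adjoin_eq_int_inv // => [x|].
    by have [i iN ai] := digfull x; exists (dig i); split => //; exact: Sdig.
  apply: digreach; first by rewrite mulr0; exact: adjoin_digit.
  by move=> q q' i iN qq'; apply: adjoin_step qq' => //; exact: Sdig.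
by move=> T /lowN; rewrite (card_le_eql SN).
Qed.

Lemma nat_residue (a : nat) (x : int) :
  (0 < a)%N -> exists i : nat, exists u : int, (i < a)%N /\ x = i%:Z + a%:Z * u.
Proof.
move=> a0; exists (absz (x %% a)%Z), (x %/ a)%Z.
have := divz_eq x a; have := modz_ge0 x (_ : a%:Z != 0).
have := ltz_pmod x (_ : 0 < a%:Z).
by move=> /(_ ltac:(lia)) h1 /(_ ltac:(lia)) h2; lia.
Qed.

(** With digits 0 to a - 1, the successor [u] of [q] is the floor of b q / a. As [b < 0], the sign
    alternates, so the induction on the absolute value treats both signs together. *)
Lemma min_digit_set_neg (R : realType) (a : nat) (b : int) :
  b < 0 -> coprimez a b -> (absz b < a)%N ->
  exists S : set R[i], [/\ min_digit_set (a%:R / b%:~R) S, S #= `I_a, S 0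
    & S `<=` @intset R].
Proof.
move=> b0 cab ba; have bn0 : b != 0 by lia.
apply: (min_digit_set_image (dig := Posz)) => //.
- by move=> T; exact: digit_set_card_ge.
- by move=> i j _ _ [].
- by exists 0%N => //; lia.
- move=> x; have [i [u [ia xE]]] := @nat_residue a x ltac:(lia).
  by exists i => //; apply/dvdzP; exists u; lia.
move=> P P0 Pstep.
suff main (n : nat) : P n%:Z /\ P (- n%:Z).
  by move=> q; have [] := main (absz q); case: (lerP 0 q) => q0;
    [rewrite gez0_abs|rewrite ltz0_abs // opprK].
elim/ltn_ind: n => n IHn.
have [->|n0] := posnP n; first by rewrite oppr0.
(* From [- n] the absolute value drops strictly, whereas [n] may lead to [- n]; hence this order. *)
have Pneg : P (- n%:Z).
  have [i [u [ia uE]]] := @nat_residue a (b * - n%:Z) ltac:(lia).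
  apply: (Pstep _ u i) => //.
  have u0 : 0 <= u by nia.
  have un : u < n%:Z by nia.
  by have [] := IHn (absz u) ltac:(lia); rewrite gez0_abs.
split => //.
have [i [u [ia uE]]] := @nat_residue a (b * n%:Z) ltac:(lia).
apply: (Pstep _ u i) => //.
have u0 : u < 0 by nia.
have : - n%:Z <= u by nia.
rewrite le_eqVlt => /orP[/eqP <- //|nu].
by have [_] := IHn (absz u) ltac:(lia); rewrite ltz0_abs // opprK.
Qed.

(** The digits - b to b are symmetric: negating the division [b n = i + a u] gives the step from
    [- n] to [- u], and [0 <= u < n]. Index [i] encodes the digit [i - b]. *)
Lemma min_digit_set_succ (R : realType) (a : nat) (b : int) :
  b != 0 -> coprimez a b -> (0 < a)%N -> a%:Z = b + 1 ->
  exists S : set R[i], [/\ min_digit_set (a%:R / b%:~R) S,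
    S #= `I_(2 * a - 1), S 0 & S `<=` @intset R].
Proof.
move=> b0 cab a0 ab.
apply: (min_digit_set_image (dig := fun i => i%:Z - b)) => //.
- by move=> T; exact: digit_set_card_ge_succ.
- by move=> i j _ _; lia.
- by exists (a - 1)%N; lia.
- move=> x; have [i [u [ia xE]]] := @nat_residue a x ltac:(lia).
  by exists (i + (a - 1))%N; [lia|apply/dvdzP; exists u; lia].
move=> P P0 Pstep.
suff main (n : nat) : P n%:Z /\ P (- n%:Z).
  by move=> q; have [] := main (absz q); case: (lerP 0 q) => q0;
    [rewrite gez0_abs|rewrite ltz0_abs // opprK].
elim/ltn_ind: n => n IHn.
have [->|n0] := posnP n; first by rewrite oppr0.
have [i [u [ia uE]]] := @nat_residue a (b * n%:Z) ltac:(lia).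
have u0 : 0 <= u by nia.
have un : u < n%:Z by nia.
have [Pu PNu] := IHn (absz u) ltac:(lia).
rewrite gez0_abs // in Pu PNu.
split.
  by apply: (Pstep _ u (i + (a - 1))%N) => //; lia.
by apply: (Pstep _ (- u) (a - 1 - i)%N) => //; lia.
Qed.

(** A step fixes [q] exactly when its digit is [- c q]. Multiples of [c] are therefore shifted by
    [- a]; the shifted digits are not multiples of [c], because [c] is coprime to [a] and [c >= 2].
    Every step then decreases the absolute value. *)
Lemma min_digit_set_pos (R : realType) (a : nat) (b : int) :
  0 < b -> coprimez a b -> b + 1 < a%:Z ->
  exists S : set R[i], [/\ min_digit_set (a%:R / b%:~R) S, S #= `I_a, S 0
    & S `<=` @intset R].
Proof.
move=> b0 cab ba; have bn0 : b != 0 by lia.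
pose c := a%:Z - b.
pose repl (i : nat) := (0 < i)%N && (c %| i%:Z)%Z.
pose dig (i : nat) : int := if repl i then i%:Z - a%:Z else i%:Z.
have repl0 : repl 0%N = false by [].
apply: (min_digit_set_image (dig := dig)) => //.
- by move=> T; exact: digit_set_card_ge.
- by move=> i j ia ja; rewrite /dig; case: (repl i); case: (repl j); lia.
- by exists 0%N; rewrite // ?/dig ?repl0; lia.
- move=> x; have [i [u [ia xE]]] := @nat_residue a x ltac:(lia).
  exists i => //; apply/dvdzP; rewrite /dig; case: (repl i).
    by exists (u + 1); lia.
  by exists u; lia.
move=> P P0 Pstep q.
move: {2}(absz q) (leqnn (absz q)) => n; elim/ltn_ind: n q => n IHn q qn.
have [->//|q0] := eqVneq q 0.
have [i [u [ia uE]]] := @nat_residue a (b * q) ltac:(lia).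
suff [v vE vq] : exists2 v, b * q = dig i + a%:Z * v & (absz v < absz q)%N.
  by apply: (Pstep _ v i) => //; apply: (IHn (absz v)); lia.
have [qneg|qpos] : q < 0 \/ 0 < q by lia.
- have u0 : u < 0 by nia.
  have qu : q <= u by nia.
  case: (boolP (repl i)) => ri.
    by exists (u + 1); [rewrite /dig ri; lia|lia].
  exists u; first by rewrite /dig (negbTE ri).
  suff : u <> q by lia.
  (* A fixed point would make [i = - c q] a positive multiple of [c], hence a replaced digit. *)
  move=> uq; case/negP: ri; apply/andP; split; first by nia.
  by apply/dvdzP; exists (- q); rewrite /c; subst u; lia.
- have u0 : 0 <= u by nia.
  have qu : u < q by nia.
  case: (boolP (repl i)) => ri; last first.
    by exists u; [rewrite /dig (negbTE ri)|lia].
  exists (u + 1); first by rewrite /dig ri; lia.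
  suff : u + 1 <> q by lia.
  (* A fixed point would give [i - a = - c q]; as [c] divides [i], it would divide [a] and
     [b = a - c], hence 1. *)
  move=> uq; case/andP: ri => _ /dvdzP[m im].
  have ca : a%:Z = (m + q) * c by rewrite mulrDl -im /c; subst q; lia.
  have cb : b = (m + q - 1) * c by rewrite mulrBl -ca /c; lia.
  have : (c %| 1%R)%Z.
    have /coprimezP[[x y] /= <-] := cab; apply: rpredD; apply: dvdz_mull.
      by rewrite ca dvdz_mull.
    by rewrite cb dvdz_mull.
  by rewrite dvdz1 => /eqP; rewrite /c; lia.
Qed.

(** * The constant term of the minimal polynomial *)

Lemma prim_minpoly_frac (R : realType) (a : nat) (b : int) (alpha : R[i]) :
  b != 0 -> (0 < a)%N -> coprimez a b -> alpha = a%:R / b%:~R ->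
  absz (prim_minpoly alpha).[0] = a.
Proof.
move=> b0 a0 cab alphaE; have b0' : b%:~R != 0 :> R[i] by rewrite intr_eq0.
pose L : {poly int} := b *: 'X - a%:Z%:P.
have sL : size L = 2%N.
  by rewrite size_polyDl size_scale ?size_polyX // size_polyN;
    case: (size_polyC a%:Z) => ->; case: eqP.
have L0 : L != 0 by rewrite -size_poly_eq0 sL.
have rootL : root (map_poly (intr : int -> R[i]) L) alpha.
  rewrite /root rmorphB /= map_polyZ map_polyX map_polyC /= !hornerE alphaE.
  by rewrite mulrC mulfVK // -pmulrn subrr.
have : is_prim_minpoly alpha (prim_minpoly alpha).
  (* A witness rules out the default value 0 of [xget]. The primitive part of [L] has positive
     leading coefficient even when [b < 0]. *)
  apply: xgetPex; exists (zprimitive L); split.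
  - by rewrite zcontents_primitive L0.
  - move: rootL; rewrite {1}(zpolyEprim L) map_polyZ rootZ //.
    by rewrite intr_eq0 zcontents_eq0.
  - move=> q q0 rootq; rewrite size_zprimitive sL.
    rewrite -(size_map_poly (ratr : {rmorphism rat -> R[i]})).
    by apply: root_size_gt1 rootq; rewrite map_poly_eq0.
move: (prim_minpoly alpha) => M [cM rootM minM].
have sM : (size M <= 2)%N.
  have -> : 2%N = size (map_poly (intr : int -> rat) L).
    by rewrite size_map_poly_id0 // intr_eq0 lead_coef_eq0.
  apply: minM; first by rewrite map_poly_eq0_id0 // intr_eq0 lead_coef_eq0.
  rewrite -map_poly_comp /= (eq_map_poly (g := intr)) // => x /=.
  by rewrite ratr_int.
have ME : M = (M`_1)%:P * 'X + (M`_0)%:P.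
  apply/polyP => -[|[|i]]; rewrite !coefE /=; try ring.
  by rewrite nth_default ?mulr0 ?addr0 //; apply: leq_trans sM _.
have Mab : M`_1 * a%:Z + M`_0 * b = 0.
  apply: (@intr_inj R[i]); move/eqP: rootM; rewrite {1}ME.
  rewrite rmorphD rmorphM /= !map_polyC map_polyX /= !hornerE alphaE => h.
  rewrite rmorphD !rmorphM /= -pmulrn -[RHS](mul0r b%:~R) -[in RHS]h.
  by field.
have /dvdzP[k M0] : (a %| M`_0)%Z.
  rewrite -(Gauss_dvdzl _ cab); apply/dvdzP; exists (- M`_1); lia.
rewrite horner_coef0 M0.
(* The relation [Mab] gives [M = k (a - b X)], so content 1 forces [k] to be a unit. *)
have kM : (k %| zcontents M)%Z.
  rewrite dvdz_contents; apply/polyOverP => -[|[|i]].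
  - by rewrite M0 dvdz_mulr.
  - have -> : M`_1 = k * - b.
      apply: (mulIf (_ : a%:Z != 0)); first by lia.
      by move/eqP: Mab; rewrite addr_eq0 => /eqP ->; rewrite M0; ring.
    by rewrite dvdz_mulr.
  - by rewrite nth_default ?dvdz0 //; apply: leq_trans sM _.
by move: kM; rewrite cM dvdz1 abszM => /eqP ->; rewrite mul1n.
Qed.

Theorem theorem2 (R : realType) (a : nat) (b : int) (alpha : R[i])
    (hb : (1 <= absz b)%N) (hab : (absz b < a)%N) (hcop : coprime a (absz b))
    (halpha : alpha = a%:R / b%:~R) :
  [/\ a%:Z <> b + 1 -> calF (absz (prim_minpoly alpha).[0]) alpha,
      a%:Z = b + 1 -> calF (2 * absz (prim_minpoly alpha).[0] - 1)%N alpha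
    & exists S : set R[i],
        [/\ min_digit_set alpha S, S 0 & S `<=` @intset R]].
Proof.
have b0 : b != 0 by lia.
have a0 : (0 < a)%N by lia.
have cab : coprimez a b by rewrite coprimezE absz_nat.
rewrite (prim_minpoly_frac b0 a0 cab halpha).
have alg : algebraicOver (ratr : rat -> R[i]) alpha.
  exists ('X - (a%:R / b%:~R)%:P); first by rewrite polyXsubC_eq0.
  rewrite rmorphB /= map_polyX map_polyC /= root_XsubC halpha.
  by rewrite fmorph_div /= ratr_nat ratr_int.
have [ab|ab] := eqVneq a%:Z (b + 1).
  have [S [mS cS S0 SZ]] := @min_digit_set_succ R a b b0 cab ltac:(lia) ab.
  rewrite -halpha in mS; split; first by move/(_ ab).
    by move=> _; split => //; exists S.
  by exists S.
have [S [mS cS S0 SZ]] : exists S : set R[i],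
    [/\ min_digit_set alpha S, S #= `I_a, S 0 & S `<=` @intset R].
  rewrite halpha; have [bneg|bpos] : b < 0 \/ 0 < b by lia.
    exact: min_digit_set_neg.
  by apply: min_digit_set_pos => //; lia.
split; [|by move/eqP: ab|by exists S].
by move=> _; split => //; exists S.
Qed.
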